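(* Let $q = 2^n$ with $n > 1$. If $q+1$ is prime or $q^2-q+1$ is prime, then the projective special unitary group $PSU_3(q)$ has a minimal logarithmic signature.
   Context: All groups are finite. For a finite group $G$, a logarithmic signature of $G$ is an ordered tuple $[A_1,\ldots,A_s]$ of subsets $A_i \subseteq G$ such that every element $g \in G$ can be written uniquely as a product $g = a_1a_2\cdots a_s$ with $a_i \in A_i$ for each $i$. Its length is $\sum_{i=1}^s |A_i|$. If $|G| = p_1^{\beta_1}\cdots p_k^{\beta_k}$ with $p_1,\ldots,p_k$ distinct primes and $\beta_j \ge 1$, every logarithmic signature has length at least $\sum_{j=1}^k \beta_j p_j$, and a logarithmic signature is called minimal (an MLS) if its length equals $\sum_{j=1}^k \beta_j p_j$. $PSU_3(q)$ is the projective special unitary group $SU_3(q)/Z(SU_3(q))$, where $SU_3(q)$ is the special unitary group of dimension $3$ over $GF(q^2)$. *)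

(* Defs.v *)
From HB Require Import structures.
From mathcomp Require Import all_boot all_order all_algebra all_fingroup all_solvable all_field.
Set Implicit Arguments. Unset Strict Implicit. Unset Printing Implicit Defensive.
Import GRing.Theory.

Section LogSig.
Variable gT : finGroupType.
Local Open Scope group_scope.

Definition is_log_sig (G : {set gT}) (As : seq {set gT}) : Prop :=
  all (fun A : {set gT} => A \subset G) As /\
  forall g, g \in G ->
    exists! a : seq gT,
      [/\ size a = size As, all2 (fun (x : gT) (A : {set gT}) => x \in A) a As
        & \prod_(x <- a) x = g].

Definition log_sig_length (As : seq {set gT}) : nat := \sum_(A <- As) #|A|.

Definition mls_bound (G : {set gT}) : nat :=
  \sum_(p <- primes #|G|) logn p #|G| * p.

Definition is_MLS (G : {set gT}) (As : seq {set gT}) : Prop :=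
  is_log_sig G As /\ log_sig_length As = mls_bound G.

Definition has_MLS (G : {set gT}) : Prop := exists As, is_MLS G As.
End LogSig.

Section Unitary.
Variable F : finFieldType.
Local Open Scope ring_scope.

Definition fchar : nat := sval (finPcharP F).
Lemma fchar_prime : prime fchar. Proof. by rewrite /fchar; case: finPcharP. Qed.
Lemma fchar_pchar : fchar \in [pchar F]. Proof. by rewrite /fchar; case: finPcharP. Qed.

(* q = sqrt |F| (when |F| is a square power of the characteristic) *)
Definition uq : nat := (fchar ^ (logn fchar #|F| %/ 2))%N.

Definition uconj (x : F) : F := x ^+ uq.

Lemma uq_pnat : [pchar F].-nat uq.
Proof.
rewrite /uq pnatX; apply/orP; left.
by rewrite pnatE ?fchar_prime //; exact: fchar_pchar.
Qed.

Lemma uconj_is_nmod_morphism : nmod_morphism uconj.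
Proof.
split=> [|x y]; rewrite /uconj; first by rewrite expr0n; case: uq uq_pnat.
exact: exprDn_pchar uq_pnat.
Qed.
Lemma uconj_is_monoid_morphism : monoid_morphism uconj.
Proof. by split=> [|x y]; rewrite /uconj ?expr1n // exprMn. Qed.

HB.instance Definition _ := GRing.isNmodMorphism.Build F F uconj
  uconj_is_nmod_morphism.
HB.instance Definition _ := GRing.isMonoidMorphism.Build F F uconj
  uconj_is_monoid_morphism.

Definition ctr (A : 'M[F]_3) : 'M[F]_3 := (map_mx uconj A)^T.

Definition SU3_set : {set {'GL_3[F]}} :=
  [set A : {'GL_3[F]} | (GLval A *m ctr (GLval A) == 1%:M) && (\det (GLval A) == 1)].

Lemma SU3_group_set : group_set SU3_set.
Proof.
apply/andP; split.
  by rewrite inE GL_1E /ctr map_mx1 trmx1 mulmx1 det1 !eqxx.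
apply/subsetP=> _ /mulsgP[A B hA hB ->]; move: hA hB; rewrite !inE GL_MxE.
case/andP=> /eqP hA /eqP dA /andP[/eqP hB /eqP dB].
rewrite /ctr map_mxM trmx_mul mulmxA -(mulmxA (GLval A)) -/(ctr (GLval B)) hB.
by rewrite mulmx1 -/(ctr (GLval A)) hA det_mulmx dA dB mulr1 !eqxx.
Qed.

Canonical SU3 := Group SU3_group_set.

Definition PSU3 := (SU3 / 'Z(SU3))%g.
End Unitary.

(* Main.v *)
Require Import Defs.
From HB Require Import structures.
From mathcomp Require Import all_boot all_order all_algebra all_fingroup all_solvable all_field.
From mathcomp Require Import ring zify.
Set Implicit Arguments. Unset Strict Implicit. Unset Printing Implicit Defensive.
Import GRing.Theory.

(* Write q = 2^n and F = GF(q^2). Either primality hypothesis forces n to be even, so q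
   = 1 mod 3. Solvable groups have minimal logarithmic signatures, by refining along
   subgroups of prime index, so it suffices to write every element of SU_3(q) uniquely
   as t c h with t, c, h in solvable subgroups T, C, H, where H contains the center.
   Take for H the stabiliser of an isotropic point P.

   Since q = 1 mod 3, there is a non-cube d fixed by the involution x -> x^q, and F^3
   carries the structure of the field L = F[t]/(t^3 - d), the Hermitian form being the
   coefficient of 1 in bar(x) y. Let T be the group of multiplications by x in L with
   bar(x) x = 1 and norm 1, and let C be a cyclic torus fixing 1, acting regularly on
   the isotropic points of the chord orthogonal to 1; P is one of these. If x is
   isotropic then bar(x) x is real with zero constant coefficient; since q is even, its
   square root m is also real with zero constant coefficient, hence lies on the chord,
   and x / m is unitary. So every T-orbit of isotropic points meets the chord, and for
   the same reason it does so only once: T C is regular on the isotropic points. *)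

(** * Minimal logarithmic signatures of products of sets and of solvable groups *)

Section LogarithmicSignatures.
Variable gT : finGroupType.
Implicit Types (G X Y : {set gT}).
Local Open Scope group_scope.

(** Valuations add up under products. [widen] makes all the sums run over the same primes, since a
    prime not dividing [m] contributes 0. *)
Lemma mls_bound_mul G X Y :
  0 < #|X| -> 0 < #|Y| -> #|G| = (#|X| * #|Y|)%N ->
  mls_bound G = (mls_bound X + mls_bound Y)%N.
Proof.
have widen m n : 0 < n -> m %| n ->
    \sum_(p <- primes m) logn p m * p = \sum_(p <- primes n) logn p m * p.
  move=> n_gt0 dvd_mn.
  have m_gt0 : 0 < m by exact: dvdn_gt0 dvd_mn.
  rewrite [RHS](bigID (mem (primes m))) /= [X in (_ + X)%N]big1 ?addn0; last first.
    move=> p pm; have := logn_gt0 p m.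
    by rewrite (negPf pm) lt0n => /negbFE/eqP->.
  rewrite -[RHS]big_filter; apply: perm_big; apply: uniq_perm.
  - exact: primes_uniq.
  - by rewrite filter_uniq ?primes_uniq.
  move=> p; rewrite mem_filter andb_idr // !mem_primes n_gt0 m_gt0 /=.
  by case/andP=> -> pm; apply: dvdn_trans dvd_mn.
move=> X_gt0 Y_gt0 cardG; rewrite /mls_bound cardG.
have XY_gt0 : 0 < #|X| * #|Y| by rewrite muln_gt0 X_gt0.
rewrite (widen #|X| _ XY_gt0) ?dvdn_mulr // (widen #|Y| _ XY_gt0) ?dvdn_mull //.
by rewrite -big_split; apply: eq_bigr => p _; rewrite lognM //= mulnDl.
Qed.

(* [is_log_sig X As] alone does not prevent products of factors from leaving [X] when
   [X] is not a group. *)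
Definition prod_closed (X : {set gT}) (As : seq {set gT}) :=
  forall a, all2 (fun (x : gT) (A : {set gT}) => x \in A) a As ->
    \prod_(x <- a) x \in X.

Definition closed_MLS (X : {set gT}) := exists2 As, is_MLS X As & prod_closed X As.

Lemma closed_MLS_MLS X : closed_MLS X -> has_MLS X.
Proof. by case=> As mlsX _; exists As. Qed.

Lemma closed_MLS_prime X : prime #|X| -> closed_MLS X.
Proof.
move=> prX; exists [:: X]; last first.
  by case=> [|x [|y s]] //=; rewrite ?andbF // andbT big_seq1.
split; last first.
  rewrite /log_sig_length /mls_bound big_seq1 primes_prime // big_seq1.
  by rewrite logn_prime // eqxx mul1n.
split; first by rewrite /= subxx.
move=> g gX; exists [:: g]; split; first by rewrite /= gX big_seq1.
by case=> [|x [|y s]] [] // _ _; rewrite big_seq1 => ->.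
Qed.

Lemma closed_MLS1 : closed_MLS [1 gT].
Proof.
exists [::]; last by case=> // _; rewrite big_nil set11.
split; last by rewrite /log_sig_length /mls_bound cards1 !big_nil.
split=> // g /set1P ->; exists [::]; split; first by rewrite /= big_nil.
by case=> [|x s] [].
Qed.

Lemma all2_size (S T : Type) (r : S -> T -> bool) s t : all2 r s t -> size s = size t.
Proof. by elim: s t => [|x s IHs] [|y t] //= /andP[_ /IHs ->]. Qed.

Lemma all2_cat (S T : Type) (r : S -> T -> bool) s1 s2 t1 t2 :
  size s1 = size t1 -> all2 r (s1 ++ s2) (t1 ++ t2) = all2 r s1 t1 && all2 r s2 t2.
Proof.
elim: s1 t1 => [|x s1 IHs] [|y t1] //= [eq_sz].
by rewrite IHs // andbA.
Qed.

(** Signatures of [X] and [Y] are concatenated. It is enough to ask that the left factor be unique,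
    because the right one then follows by cancellation. *)
Lemma closed_MLS_mul G X Y :
    X \subset G -> Y \subset G -> G = X * Y ->
    (forall x x' y y', x \in X -> x' \in X -> y \in Y -> y' \in Y ->
       x * y = x' * y' -> x = x') ->
  closed_MLS X -> closed_MLS Y -> closed_MLS G.
Proof.
move=> sXG sYG defG inj [As [[sAX uniqX] lenX] clX] [Bs [[sBY uniqY] lenY] clY].
have [G0 | [g gG]] := set_0Vmem G.
  have X0 : X = G by apply/eqP; rewrite eqEsubset sXG G0 sub0set.
  by exists As; rewrite -X0.
have: g \in X * Y by rewrite -defG.
case/mulsgP=> x0 y0 Xx0 Yy0 _.
exists (As ++ Bs); last first.
  move=> c cP; have szc := all2_size cP.
  move: cP; rewrite -[c](cat_take_drop (size As)) all2_cat; last first.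
    by rewrite size_takel // szc size_cat leq_addr.
  by case/andP=> aP bP; rewrite big_cat /= defG mem_mulg ?clX ?clY.
split; last first.
  rewrite /log_sig_length big_cat /= -/(log_sig_length As) lenX.
  rewrite -/(log_sig_length Bs) lenY (@mls_bound_mul G X Y) //.
  - by apply/card_gt0P; exists x0.
  - by apply/card_gt0P; exists y0.
  rewrite defG -cardsX -(card_in_imset (f := fun p => p.1 * p.2)).
    apply: eq_card => z; apply/mulsgP/imsetP.
      by case=> x y Xx Yy ->; exists (x, y) => //; rewrite inE Xx.
    by case=> -[x y]; rewrite inE => /andP[Xx Yy] ->; exists x y.
  move=> [x y] [x' y']; rewrite !inE /= => /andP[Xx Yy] /andP[Xx' Yy'] eq_xy.
  have eq_x := inj _ _ _ _ Xx Xx' Yy Yy' eq_xy.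
  by move: eq_xy; rewrite eq_x => /mulgI ->.
split.
  rewrite all_cat; apply/andP; split; apply/allP=> A.
    by move/(allP sAX)/subset_trans; apply.
  by move/(allP sBY)/subset_trans; apply.
move=> h; rewrite defG => /mulsgP[x y Xx Yy ->].
have [a [[sza aP xE] uniqa]] := uniqX x Xx.
have [b [[szb bP yE] uniqb]] := uniqY y Yy.
exists (a ++ b); split.
  by rewrite !size_cat sza szb all2_cat // aP bP big_cat /= xE yE.
move=> c [szc cP cE].
have sz_take : size (take (size As) c) = size As.
  by rewrite size_takel // szc size_cat leq_addr.
move: cP cE; rewrite -[c](cat_take_drop (size As)) all2_cat //.
case/andP=> aP' bP'; rewrite big_cat /= => cE.
(* [prod_closed] puts the two partial products in [X] and [Y], as [inj] requires. *)
have eq_x := inj _ _ _ _ (clX _ aP') Xx (clY _ bP') Yy cE.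
move: cE; rewrite eq_x => /mulgI eq_y.
by congr (_ ++ _); [apply: uniqa | apply: uniqb]; split=> //; apply: all2_size bP'.
Qed.

(** A nontrivial solvable group has a normal subgroup of prime index. A transversal of it has prime
    size, so it is a minimal signature by itself, and induction handles the subgroup. *)
Lemma solvable_closed_MLS (G : {group gT}) : solvable G -> closed_MLS G.
Proof.
have [m] := ubnP #|G|; elim: m G => // m IHm G ltGm solG.
have [-> | ntG] := eqVneq (G : {set gT}) 1; first exact: closed_MLS1.
have [H nsHG pr_index] := sol_prime_factor_exists solG ntG.
have sHG := normal_sub nsHG.
have inX x : x \in repr @: rcosets H G -> x \in G /\ repr (H :* x) = x.
  case/imsetP=> _ /rcosetsP[g Gg ->] ->.
  have := mem_repr_rcoset H g => Hg; split; last by rewrite (rcoset_eqP Hg).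
  case/rcosetP: Hg => h Hh ->; rewrite groupM //; exact: (subsetP sHG).
apply: (@closed_MLS_mul G H (repr @: rcosets H G)) => //.
- by apply/subsetP=> x /inX[].
- apply/setP=> g; apply/idP/mulsgP=> [Gg | [h x Hh /inX[Gx _] ->]].
    have [h Hh def_r] := rcosetP (mem_repr_rcoset H g).
    exists h^-1 (repr (H :* g)); last by rewrite def_r mulKg.
      by rewrite groupV.
    by apply: imset_f; apply/rcosetsP; exists g.
  by rewrite groupM // (subsetP sHG).
- move=> h h' x x' Hh Hh' /inX[_ def_x] /inX[_ def_x'] eq_hx.
  have : H :* x = H :* x'.
    by rewrite -[in LHS](rcoset_id Hh) -rcosetM eq_hx rcosetM (rcoset_id Hh').
  by move=> eqHx; move: eq_hx; rewrite -def_x eqHx def_x' => /mulIg.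
- apply: IHm; last exact: solvableS solG.
  rewrite ltnS in ltGm; apply: (@leq_trans #|G|) => //.
  rewrite -(Lagrange sHG) ltn_Pmulr ?cardG_gt0 //.
  exact: prime_gt1.
- apply: closed_MLS_prime; rewrite card_in_imset // => K K'.
  case/rcosetsP=> g _ -> /rcosetsP[g' _ ->] eq_r.
  have /rcoset_eqP <- := mem_repr_rcoset H g; rewrite eq_r.
  by have /rcoset_eqP -> := mem_repr_rcoset H g'.
Qed.

End LogarithmicSignatures.

(** * From a factorization of a group to a signature of a quotient *)

Section QuotientFactorization.
Local Open Scope group_scope.

(* [H] plays the role of a point stabiliser, and [A * B] of a set acting regularly on
   the points. *)
Lemma has_MLS_quotient_mul (gT : finGroupType) (G Z A B H : {group gT}) :
    Z <| G -> Z \subset H -> H \subset G -> A \subset G -> B \subset G ->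
    solvable A -> solvable B -> solvable H ->
    (forall g, g \in G -> exists2 a, a \in A & exists2 b, b \in B & b^-1 * (a^-1 * g) \in H) ->
    (forall a b b', a \in A -> b \in B -> b' \in B -> b^-1 * (a * b') \in H -> a = 1 /\ b = b') ->
  has_MLS (G / Z).
Proof.
move=> nsZG sZH sHG sAG sBG solA solB solH cover inj.
have nZG := normal_norm nsZG.
have morphZ x y : x \in G -> y \in G -> coset Z (x * y) = coset Z x * coset Z y.
  by move=> Gx Gy; rewrite morphM ?(subsetP nZG).
have quoE (K : {group gT}) : K \subset G -> K / Z = coset Z @: K.
  by move=> sKG; rewrite /quotient morphimEsub ?(subset_trans sKG).
have sAG' := subsetP sAG; have sBG' := subsetP sBG; have sHG' := subsetP sHG.
have injZ a a' b b' h h' : a \in A -> a' \in A -> b \in B -> b' \in B ->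
    h \in H -> h' \in H ->
    coset Z a * (coset Z b * coset Z h) = coset Z a' * (coset Z b' * coset Z h') ->
    a = a' /\ b = b'.
  move=> Aa Aa' Bb Bb' Hh Hh'.
  have [Ga Ga' Gb] := And3 (sAG' _ Aa) (sAG' _ Aa') (sBG' _ Bb).
  have [Gb' Gh Gh'] := And3 (sBG' _ Bb') (sHG' _ Hh) (sHG' _ Hh').
  rewrite -!morphZ ?groupM // => eqZ.
  (* The two products agree modulo [Z], which lies in [H], so the discrepancy is absorbed in [H] and
     [inj] applies to [a^-1 * a']. *)
  have Hx : b^-1 * ((a^-1 * a') * b') \in H.
    have -> : b^-1 * ((a^-1 * a') * b') =
        h * ((a * (b * h))^-1 * (a' * (b' * h'))) * h'^-1.
      by rewrite !invMg !mulgA mulgV mul1g mulgK.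
    rewrite groupMr ?groupV // groupMl //; apply: (subsetP sZH).
    apply: coset_idr; first by rewrite (subsetP nZG) // !(groupM, groupV).
    rewrite morphZ; [|by rewrite groupV !groupM|by rewrite !groupM].
    by rewrite -eqZ -morphZ ?groupV ?groupM // mulVg morph1.
  have [/eqP] := inj _ _ _ (groupM (groupVr Aa) Aa') Bb Bb' Hx.
  by rewrite -eq_mulVg1 => /eqP.
have sol_quo (K : {group gT}) : solvable K -> closed_MLS (K / Z).
  by move=> solK; apply: solvable_closed_MLS; apply: quotient_sol.
apply: closed_MLS_MLS.
apply: (@closed_MLS_mul _ (G / Z) (A / Z) ((B / Z) * (H / Z))).
- by rewrite quotientS.
- by rewrite mul_subG ?quotientS.
- apply/eqP; rewrite eqEsubset !mul_subG ?quotientS // andbT.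
  rewrite quoE //; apply/subsetP=> _ /imsetP[g Gg ->].
  have [a Aa [b Bb Hh]] := cover g Gg.
  have [Ga Gb] := (sAG' _ Aa, sBG' _ Bb).
  apply/mulsgP; exists (coset Z a) (coset Z (a^-1 * g)).
  + by rewrite quoE ?imset_f.
  + apply/mulsgP; exists (coset Z b) (coset Z (b^-1 * (a^-1 * g))).
    * by rewrite quoE ?imset_f.
    * by rewrite quoE ?imset_f.
    by rewrite -morphZ ?(groupM, groupV) // mulKVg.
  by rewrite -morphZ ?(groupM, groupV) // mulKVg.
- move=> x x' y y'; rewrite !quoE // => /imsetP[a Aa ->] /imsetP[a' Aa' ->].
  case/mulsgP=> _ _ /imsetP[b Bb ->] /imsetP[h Hh ->] ->.
  case/mulsgP=> _ _ /imsetP[b' Bb' ->] /imsetP[h' Hh' ->] -> eqZ.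
  by have [-> _] := injZ _ _ _ _ _ _ Aa Aa' Bb Bb' Hh Hh' eqZ.
- exact: sol_quo.
apply: (@closed_MLS_mul _ _ (B / Z) (H / Z)) => //; try exact: sol_quo.
- by rewrite mulG_subl.
- by rewrite mulG_subr.
move=> x x' y y'; rewrite !quoE // => /imsetP[b Bb ->] /imsetP[b' Bb' ->].
case/imsetP=> h Hh -> /imsetP[h' Hh' ->] eqZ.
have eqZ1 : coset Z 1 * (coset Z b * coset Z h) = coset Z 1 * (coset Z b' * coset Z h').
  by rewrite eqZ.
by have [_ ->] := injZ _ _ _ _ _ _ (group1 A) (group1 A) Bb Bb' Hh Hh' eqZ1.
Qed.
End QuotientFactorization.

(** * Parity of n from the primality hypothesis *)

Lemma dvd3_exp2D1 n : (3 %| 2 ^ n + 1) = odd n.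
Proof.
have [m ->]: exists m, n = odd n + m.*2 by exists n./2; rewrite odd_double_half.
rewrite oddD odd_double addbF oddb expnD -mul2n expnM /dvdn.
rewrite -modnDml -modnMmr -modnXm (_ : 2 ^ 2 %% 3 = 1) // exp1n.
by case: (odd n).
Qed.

(** For odd n, 3 divides q + 1, hence also q^2 - q + 1 = (q + 1)(q - 2) + 3. Both numbers exceed 3
    because q is at least 4, so neither is prime. *)
Lemma prime_criterion_even n : 1 < n ->
  prime (2 ^ n + 1) \/ prime ((2 ^ n) ^ 2 - 2 ^ n + 1) -> ~~ odd n.
Proof.
move=> n_gt1; rewrite -dvd3_exp2D1 => pr; apply/negP => d3.
have q_ge4 : 4 <= 2 ^ n by rewrite -[4]/(2 ^ 2) leq_exp2l.
have prime3 m : prime m -> 3 %| m -> m = 3.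
  by move=> prm; rewrite dvdn_prime2 // => /eqP.
case: pr => [pr|pr]; first by have := prime3 _ pr d3; lia.
have d3' : 3 %| (2 ^ n) ^ 2 - 2 ^ n + 1.
  have -> : (2 ^ n) ^ 2 - 2 ^ n + 1 = (2 ^ n + 1) * (2 ^ n - 2) + 3 by nia.
  by rewrite dvdn_addl // dvdn_mulr.
by have := prime3 _ pr d3'; nia.
Qed.

(** * Arithmetic of GF(q^2) in characteristic 2: conjugation, norms, traces and cubes *)

Section QuadraticField.
Variables (n : nat) (F : finFieldType).
Hypotheses (n_gt0 : 0 < n) (cardF : #|F| = (2 ^ n) ^ 2).
Local Open Scope ring_scope.
Local Notation q := (2 ^ n)%N.
Local Notation bar := (@uconj F).

Lemma pchar2 : 2 \in [pchar F].
Proof. by apply: (card_finPcharP (n := n * 2)); rewrite // cardF expnM. Qed.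

Lemma two0 : 1 + 1 = 0 :> F.
Proof. exact: (pcharf0 pchar2). Qed.

Lemma addrr2 (x : F) : x + x = 0.
Proof. by rewrite -mulr2n -mulr_natl (pcharf0 pchar2) mul0r. Qed.

Lemma oppr2 (x : F) : - x = x.
Proof. by apply/esym/eqP; rewrite -addr_eq0 addrr2. Qed.

Lemma addr2_eq (x y : F) : x + y = 0 -> x = y.
Proof. by move/eqP; rewrite addr_eq0 oppr2 => /eqP. Qed.

Lemma uqE : uq F = q.
Proof.
have := fchar_pchar F; rewrite (pcharf_eq pchar2) inE /uq => /eqP->.
by rewrite cardF -expnM pfactorK // mulnK.
Qed.

Lemma barE x : bar x = x ^+ q.
Proof. by rewrite /uconj uqE. Qed.

Lemma barK : involutive bar.
Proof. by move=> x; rewrite !barE -exprM -[RHS]expf_card cardF mulnn. Qed.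

Lemma norm_exp x : x * bar x = x ^+ q.+1.
Proof. by rewrite barE -exprS. Qed.

Lemma bar_eq0 x : (bar x == 0) = (x == 0).
Proof. exact: fmorph_eq0. Qed.

Lemma sqr_inj (x y : F) : x ^+ 2 = y ^+ 2 -> x = y.
Proof.
move=> eq_sq; apply/eqP; rewrite -subr_eq0 -sqrf_eq0; apply/eqP.
by rewrite sqrrB eq_sq addrAC addrr2 mulr2n addrr2 subr0.
Qed.

(** Squaring is the Frobenius map, of order dividing 2n, so its (2n - 1)-st iterate inverts it. *)
Lemma sqrt_ex (x : F) : exists y, y ^+ 2 = x.
Proof.
exists (x ^+ (2 ^ (n * 2).-1)); rewrite -exprM -expnSr prednK ?muln_gt0 ?n_gt0 //.
by rewrite expnM -cardF expf_card.
Qed.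

(** The polynomial X^q + X has degree q < q^2, so some trace is nonzero. Traces are fixed by [bar],
    so dividing by this one gives trace 1. *)
Lemma trace1_ex : exists w, w + bar w = 1.
Proof.
have [x xP] : exists x, x + bar x != 0.
  apply/existsP; rewrite -negb_forall; apply/negP => /forallP tr0.
  have q_gt1 : (1 < q)%N by rewrite -{1}(expn0 2) ltn_exp2l.
  pose p : {poly F} := 'X^q + 'X.
  have szp : size p = q.+1 by rewrite size_polyDl ?size_polyXn ?size_polyX.
  have p0 : p != 0 by rewrite -size_poly_eq0 szp.
  have := max_poly_roots p0 _ (enum_uniq F); rewrite szp -cardE cardF.
  have -> : all (root p) (enum F).
    apply/allP=> x _; rewrite rootE !hornerE -barE addrC.
    exact: tr0.
  by move/(_ isT); rewrite ltnS leqNgt -{1}(expn1 q) ltn_exp2l.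
exists (x / (x + bar x)); rewrite rmorphM fmorphV rmorphD /= barK [bar x + x]addrC.
by rewrite -mulrDl divff.
Qed.

Hypothesis q_mod3 : (q %% 3 = 1)%N.

Lemma dvd3_qP : exists m, q = (3 * m + 1)%N.
Proof. by exists (q %/ 3)%N; rewrite {1}(divn_eq q 3) q_mod3 mulnC. Qed.

(** As q + 1 is 2 modulo 3, the norm condition reduces to [a ^+ 2 = 1]. *)
Lemma cube_norm1_inj (a : F) : a ^+ 3 = 1 -> a * bar a = 1 -> a = 1.
Proof.
have [m qE] := dvd3_qP.
rewrite norm_exp qE -addnS => a3.
rewrite exprD exprM a3 expr1n mul1r => a2; apply: sqr_inj.
by rewrite expr1n.
Qed.

Lemma cube_norm1_ex a : a * bar a = 1 -> exists2 f, f ^+ 3 * a = 1 & f * bar f = 1.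
Proof.
have [m qE] := dvd3_qP.
(* With q = 3m + 1, the exponent satisfies 3(2m + 1) + 1 = 2(q + 1). *)
move=> a1; exists (a ^+ (m * 2 + 1)); last first.
  by rewrite rmorphXn -exprMn a1 expr1n.
rewrite -exprM -exprSr.
have -> : ((m * 2 + 1) * 3).+1 = (q.+1 * 2)%N by rewrite qE; lia.
by rewrite exprM -norm_exp a1 expr1n.
Qed.

(** The norm u^(q+1) of a generator u of the multiplicative group is fixed by [bar]. It is not a
    cube, since 3 divides the order q^2 - 1 of u but not the exponent q + 1. *)
Lemma noncube_ex : exists d : F, [/\ bar d = d, d != 0 & forall x, x ^+ 3 <> d].
Proof.
have [m qE] := dvd3_qP.
have /cyclicP[u genu] := field_unit_group_cyclic [group of [set: {unit F}]].
have ordu : #[u]%g = (q ^ 2).-1.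
  by rewrite orderE -genu card_finField_unit cardF.
have d0 : val u ^+ q.+1 != 0 by rewrite expf_neq0 // -unitfE; case: (u).
exists (val u ^+ q.+1); split=> //.
- by rewrite -norm_exp rmorphM /= barK mulrC.
move=> x x3.
have xu : x \is a GRing.unit.
  by rewrite unitfE; apply: contraNneq d0 => x0; rewrite -x3 x0 expr0n.
pose v : {unit F} := FinRing.unit _ xu.
have /cycleP[k vE] : v \in <[u]>%g by rewrite -genu inE.
have: (v ^+ 3 == u ^+ q.+1)%g by rewrite -val_eqE !FinRing.val_unitX /= x3.
rewrite vE -expgM eq_expg_mod_order ordu => eqm.
have d3 : (3 %| (q ^ 2).-1)%N.
  have -> : (q ^ 2).-1 = (3 * (m * (q.+1)))%N by rewrite qE; nia.
  exact: dvdn_mulr.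
have : (k * 3 == q.+1 %[mod 3])%N.
  by move/eqP: eqm => /(congr1 (modn^~ 3)); rewrite !modn_dvdm // => ->.
by rewrite modnMl -addn1 -modnDml q_mod3.
Qed.

(* The ring tactic only rewrites coefficients syntactically equal to the ones it is
   given. *)
Lemma even0 : [/\ 2 = 0 :> F, 4 = 0 :> F, 6 = 0 :> F & 8 = 0 :> F].
Proof.
have h : 2 = 0 :> F := pcharf0 pchar2.
by split=> //; [have -> : 4 = 2 * 2 :> F by ring | have -> : 6 = 3 * 2 :> F by ring
               |have -> : 8 = 4 * 2 :> F by ring]; rewrite h mulr0.
Qed.

Local Ltac ring_char2 := apply: addr2_eq; rewrite ?oppr2;
  let h2 := fresh in let h4 := fresh in let h6 := fresh in let h8 := fresh in
  have [h2 h4 h6 h8] := even0; ring: h2 h4 h6 h8.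

(** * Explicit calculus of 3 by 3 matrices and column vectors *)

Definition mx3 (a b c d e f g h i : F) : 'M[F]_3 :=
  \matrix_(r, s) nth 0 (nth [::] [:: [:: a; b; c]; [:: d; e; f]; [:: g; h; i]] r) s.

Definition cv3 (a b c : F) : 'cV[F]_3 := \col_r nth 0 [:: a; b; c] r.

Lemma forall_ord3 (P : 'I_3 -> Prop) :
  P 0 -> P 1 -> P (2%:R) -> forall i, P i.
Proof.
move=> P0 P1 P2 [[|[|[|i]]] // lt_i3].
- by rewrite (_ : Ordinal _ = 0) //; apply: val_inj.
- by rewrite (_ : Ordinal _ = 1) //; apply: val_inj.
- by rewrite (_ : Ordinal _ = 2%:R) //; apply: val_inj.
Qed.

Lemma mx3E (A : 'M[F]_3) :
  A = mx3 (A 0 0) (A 0 1) (A 0 2%:R) (A 1 0) (A 1 1) (A 1 2%:R)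
          (A 2%:R 0) (A 2%:R 1) (A 2%:R 2%:R).
Proof.
by apply/matrixP; elim/forall_ord3; elim/forall_ord3; rewrite mxE.
Qed.

Lemma mx3P (A : 'M[F]_3) : exists a b c d e f g h i, A = mx3 a b c d e f g h i.
Proof. by rewrite [A]mx3E; do 9!eexists. Qed.

Lemma cv3P (v : 'cV[F]_3) : exists a b c, v = cv3 a b c.
Proof.
exists (v 0 0), (v 1 0), (v 2%:R 0).
by apply/matrixP => i j; rewrite ord1; elim/forall_ord3: i; rewrite mxE.
Qed.

Lemma mx3_inj a b c d e f g h i a' b' c' d' e' f' g' h' i' :
  mx3 a b c d e f g h i = mx3 a' b' c' d' e' f' g' h' i' ->
  [/\ [/\ a = a', b = b' & c = c'], [/\ d = d', e = e' & f = f']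
    & [/\ g = g', h = h' & i = i']].
Proof.
move/matrixP=> eqA; split; split;
  [move: (eqA 0 0) | move: (eqA 0 1) | move: (eqA 0 2%:R)
  |move: (eqA 1 0) | move: (eqA 1 1) | move: (eqA 1 2%:R)
  |move: (eqA 2%:R 0) | move: (eqA 2%:R 1) | move: (eqA 2%:R 2%:R)];
  by rewrite !mxE.
Qed.

Lemma cv3_inj a b c a' b' c' :
  cv3 a b c = cv3 a' b' c' -> [/\ a = a', b = b' & c = c'].
Proof.
move/matrixP=> eqA.
by split; [move: (eqA 0 0) | move: (eqA 1 0) | move: (eqA 2%:R 0)]; rewrite !mxE.
Qed.

Lemma mul_mx3 a b c d e f g h i a' b' c' d' e' f' g' h' i' :
  mx3 a b c d e f g h i *m mx3 a' b' c' d' e' f' g' h' i' =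
  mx3 (a * a' + b * d' + c * g') (a * b' + b * e' + c * h') (a * c' + b * f' + c * i')
      (d * a' + e * d' + f * g') (d * b' + e * e' + f * h') (d * c' + e * f' + f * i')
      (g * a' + h * d' + i * g') (g * b' + h * e' + i * h') (g * c' + h * f' + i * i').
Proof.
apply/matrixP; elim/forall_ord3; elim/forall_ord3;
  by rewrite !mxE !big_ord_recl big_ord0 !mxE /= addr0 addrA.
Qed.

Lemma mul_mx3_cv3 a b c d e f g h i x y z :
  mx3 a b c d e f g h i *m cv3 x y z =
  cv3 (a * x + b * y + c * z) (d * x + e * y + f * z) (g * x + h * y + i * z).
Proof.
apply/matrixP => r j; rewrite ord1; elim/forall_ord3: r;
  by rewrite !mxE !big_ord_recl big_ord0 !mxE /= addr0 addrA.
Qed.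

Lemma scale_cv3 a x y z : a *: cv3 x y z = cv3 (a * x) (a * y) (a * z).
Proof. by apply/matrixP => r j; rewrite ord1; elim/forall_ord3: r; rewrite !mxE. Qed.

Lemma mx3_1 : 1%:M = mx3 1 0 0 0 1 0 0 0 1.
Proof. by apply/matrixP; elim/forall_ord3; elim/forall_ord3; rewrite !mxE. Qed.

Lemma ctr_mx3 a b c d e f g h i :
  ctr (mx3 a b c d e f g h i) =
  mx3 (bar a) (bar d) (bar g) (bar b) (bar e) (bar h) (bar c) (bar f) (bar i).
Proof. by apply/matrixP; elim/forall_ord3; elim/forall_ord3; rewrite !mxE. Qed.

Lemma det_mx3 a b c d e f g h i :
  \det (mx3 a b c d e f g h i) =
  a * (e * i - f * h) - b * (d * i - f * g) + c * (d * h - e * g).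
Proof.
rewrite (expand_det_row _ 0) !big_ord_recl big_ord0 /cofactor !(expand_det_row _ 0).
rewrite !big_ord_recl !big_ord0 /cofactor !det_mx11 !mxE /=.
by rewrite !exprS !expr0; ring.
Qed.

Lemma ctrM (A B : 'M[F]_3) : ctr (A *m B) = ctr B *m ctr A.
Proof. by rewrite /ctr map_mxM trmx_mul. Qed.

(** * The stabiliser of an isotropic point is solvable and contains the center *)

Section PointStabiliser.
Local Open Scope group_scope.
Local Notation GL := {'GL_3[F]}.
Implicit Types g h z : GL.

Lemma GL_inj g h : GLval g = GLval h -> g = h.
Proof. exact: val_inj. Qed.

Lemma mulmx_GLV g (v w : 'cV[F]_3) : (GLval g *m v)%R = w -> v = (GLval g^-1 *m w)%R.
Proof. by move=> <-; rewrite mulmxA -GL_MxE mulVg GL_1E mul1mx. Qed.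

Lemma SU3P g :
  reflect [/\ (GLval g *m ctr (GLval g) = 1%:M)%R, (ctr (GLval g) *m GLval g = 1%:M)%R
            & \det (GLval g) = 1%R] (g \in SU3 F).
Proof.
rewrite inE; apply: (iffP andP) => [[/eqP gg /eqP dg] | [-> _ ->]]; last by [].
by split=> //; apply: mulmx1C.
Qed.

Lemma SU3_lift (A : 'M[F]_3) : (ctr A *m A = 1%:M)%R -> \det A = 1%R ->
  exists2 g : GL, g \in SU3 F & GLval g = A.
Proof.
move=> AA dA; have Au : A \in GRing.unit by rewrite unitmxE dA unitr1.
exists (FinRing.unit _ Au : GL) => //; apply/SU3P; split=> //=; exact: mulmx1C.
Qed.

(** Isotropic for the standard Hermitian form, since 1 + 1 = 0. *)
Definition isoP : 'cV[F]_3 := (cv3 0 1 1)%R.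

Definition line_stab := [set g in SU3 F | [exists c, GLval g *m isoP == c *: isoP]%R].
Definition vector_stab := [set g in SU3 F | GLval g *m isoP == isoP]%R.

Lemma line_stabP g :
  reflect (g \in SU3 F /\ exists c : F, (GLval g *m isoP = c *: isoP)%R) (g \in line_stab).
Proof.
rewrite [X in reflect _ X]inE; apply: (iffP andP) => [[Gg /existsP[c /eqP gP]] | [Gg [c gP]]].
  by split=> //; exists c.
by split=> //; apply/existsP; exists c; apply/eqP.
Qed.

Lemma line_stab_group_set : group_set line_stab.
Proof.
apply/group_setP; split=> [|g h /line_stabP[Gg [a ga]] /line_stabP[Gh [b hb]]].
  by apply/line_stabP; rewrite group1; split=> //; exists 1%R; rewrite GL_1E mul1mx scale1r.
apply/line_stabP; rewrite groupM //; split=> //; exists (b * a)%R.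
by rewrite GL_MxE -mulmxA hb -scalemxAr ga scalerA.
Qed.
Canonical line_stab_group := Group line_stab_group_set.

Lemma vector_stabP g :
  reflect (g \in SU3 F /\ (GLval g *m isoP = isoP)%R) (g \in vector_stab).
Proof. by rewrite [X in reflect _ X]inE; apply: (iffP andP) => -[? /eqP]. Qed.

Lemma vector_stab_group_set : group_set vector_stab.
Proof.
apply/group_setP; split=> [|g h].
  by apply/vector_stabP; rewrite group1 GL_1E mul1mx.
case/vector_stabP=> Gg gP /vector_stabP[Gh hP].
by apply/vector_stabP; rewrite groupM // GL_MxE -mulmxA hP gP.
Qed.
Canonical vector_stab_group := Group vector_stab_group_set.

(** The swap s of the last two coordinates has determinant -1 = 1, so it lies in [SU3 F]. The image
    of 1 + s is the line of [isoP], and whatever commutes with s preserves it. *)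
Lemma center_sub_line_stab : 'Z(SU3 F) \subset line_stab.
Proof.
have [s Gs sE] : exists2 s : GL, s \in SU3 F & GLval s = (mx3 1 0 0 0 0 1 0 1 0)%R.
  apply: SU3_lift.
    by rewrite mx3_1 ctr_mx3 mul_mx3 !rmorph1 !rmorph0; congr mx3; ring.
  by rewrite det_mx3; ring_char2.
apply/subsetP=> z /centerP[Gz /(_ s Gs) commz]; apply/line_stabP; split=> //.
have comm : (GLval z *m GLval s = GLval s *m GLval z)%R by rewrite -!GL_MxE commz.
have [a [b [c [d' [e' [f [g [h [i zE]]]]]]]]] := mx3P (GLval z).
move: comm; rewrite sE zE !mul_mx3 => /mx3_inj.
rewrite !(mulr0, mulr1, mul0r, mul1r, addr0, add0r).
case=> -[_ eq_c eq_b] _ [_ eq_i eq_h].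
exists (e' + f)%R; rewrite /isoP mul_mx3_cv3 scale_cv3.
congr cv3; rewrite ?(mulr0, mulr1, add0r) //.
  by rewrite eq_c addrr2.
by rewrite addrC -eq_i -eq_h.
Qed.

(* In characteristic 2 a matrix fixing an isotropic vector [P] and its polar [P^*], and
   having determinant 1, acts trivially on [P^perp / P], hence is unipotent. *)
Lemma vector_stab_exp4 g : g \in vector_stab -> g ^+ 4 = 1.
Proof.
case/vector_stabP=> /SU3P[_ gg dg] gP.
have gP' : (ctr (GLval g) *m isoP = isoP)%R by rewrite -{1}gP mulmxA gg mul1mx.
have [a [b [c [r [s [t [x [y [z gE]]]]]]]]] := mx3P (GLval g).
move: gP gP' dg; rewrite gE ctr_mx3 /isoP !mul_mx3_cv3 det_mx3.
rewrite !(mulr0, mulr1, add0r) => /cv3_inj[bc st yz] /cv3_inj[rx sy tz].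
have conj0 u v : (bar u + bar v = 0 -> v = u)%R.
  rewrite -rmorphD => /eqP; rewrite bar_eq0 addr_eq0 oppr2.
  by move/eqP->.
have conj1 u v : (bar u + bar v = 1 -> v = 1 + u)%R.
  rewrite -rmorphD => /(congr1 bar); rewrite barK rmorph1 => <-.
  by rewrite addrC addrA addrr2 add0r.
have cE : c = b by apply/esym/addr2_eq.
have tE : t = (1 + s)%R by rewrite -st addrAC addrr2 add0r.
have xE := conj0 _ _ rx; have yE := conj1 _ _ sy.
have zE : z = s by rewrite (conj1 _ _ tz) tE addrA addrr2 add0r.
rewrite {}cE {}tE {}xE {}yE {}zE in gE * => dg.
have a1 : a = 1%R by rewrite -dg; ring_char2.
rewrite {}a1 in gE.
(* The square differs from the identity by [r * b] times the matrix with all ones in the lower right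
   block, whose square is 0. *)
have g2E : GLval (g * g) = (mx3 1 0 0 0 (1 + r * b) (r * b) 0 (r * b) (1 + r * b))%R.
  by rewrite GL_MxE gE mul_mx3; congr mx3; ring_char2.
apply: GL_inj; rewrite !expgS expg0 mulg1 mulgA GL_MxE g2E mul_mx3 GL_1E -[RHS]/(1%:M)%R mx3_1.
by congr mx3; ring_char2.
Qed.

(** The factor by which an element scales [isoP] is multiplicative, so commutators fix [isoP]; the
    fixer of [isoP] is a 2-group because its exponent divides 4. *)
Lemma line_stab_solvable : solvable line_stab.
Proof.
have sol_vec : solvable vector_stab.
  apply: (@pgroup_sol _ 2); apply/pgroupP => p pr_p /(Cauchy pr_p)[g Ug og].
  have : (p %| 2 ^ 2)%N by rewrite -og order_dvdn vector_stab_exp4.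
  by rewrite Euclid_dvdX // andbT dvdn_prime2.
have sder : (line_stab^`(1) \subset vector_stab).
  rewrite derg1 gen_subG; apply/subsetP=> _ /imset2P[g h Hg Hh ->].
  have [Gg [a ga]] := line_stabP _ Hg; have [Gh [b hb]] := line_stabP _ Hh.
  apply/vector_stabP; rewrite groupR //; split=> //.
  rewrite /commg /conjg; apply/esym.
  have -> : g^-1 * (h^-1 * (g * h)) = (h * g)^-1 * (g * h) by rewrite invMg mulgA.
  rewrite GL_MxE -mulmxA; apply: mulmx_GLV.
  by rewrite !GL_MxE -!mulmxA ga hb -!scalemxAr ga hb !scalerA mulrC.
by rewrite (series_sol (der_normal 1 _)) (solvableS sder) // abelian_sol ?der_abelian.
Qed.

End PointStabiliser.

(** * The cubic extension L = F[t]/(t^3 - d), its norm and its conjugation *)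

Section CubicAlgebra.
Variables d e : F.
Hypotheses (mul_de : d * e = 1) (bar_d : bar d = d) (noncube_d : forall x, x ^+ 3 <> d).

Lemma d_neq0 : d != 0.
Proof. by apply: contra_eq_neq mul_de => ->; rewrite mul0r eq_sym oner_eq0. Qed.

Lemma bar_e : bar e = e.
Proof. by apply: (mulfI d_neq0); rewrite -{1}bar_d -rmorphM mul_de rmorph1. Qed.

(* Coordinates are with respect to [1], [t], [t ^ 2 / d], where [t ^ 3 = d]. *)
Definition Lmul (x y : F * F * F) : F * F * F :=
  let: (x0, x1, x2) := x in let: (y0, y1, y2) := y in
  (x0 * y0 + x1 * y2 + x2 * y1, x0 * y1 + x1 * y0 + e * (x2 * y2),
   x0 * y2 + x2 * y0 + d * (x1 * y1)).
Definition Lone : F * F * F := (1, 0, 0).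
Definition Lbar (x : F * F * F) := let: (x0, x1, x2) := x in (bar x0, bar x1, bar x2).
Definition Lscale a (x : F * F * F) := let: (x0, x1, x2) := x in (a * x0, a * x1, a * x2).
Definition Lnorm (x : F * F * F) :=
  let: (x0, x1, x2) := x in
  x0 ^+ 3 + d * x1 ^+ 3 + e * x2 ^+ 3 - 3%:R * (x0 * x1 * x2).
(** The product of the other two conjugates of [x] over F. *)
Definition Ladj (x : F * F * F) :=
  let: (x0, x1, x2) := x in
  (x0 ^+ 2 - x1 * x2, e * x2 ^+ 2 - x0 * x1, d * x1 ^+ 2 - x0 * x2).
Definition Lmx (x : F * F * F) :=
  let: (x0, x1, x2) := x in mx3 x0 x2 x1 x1 x0 (e * x2) x2 (d * x1) x0.
Definition Lcv (x : F * F * F) := let: (x0, x1, x2) := x in cv3 x0 x1 x2.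

Lemma LmulC x y : Lmul x y = Lmul y x.
Proof. by case: x y => [[x0 x1] x2] [[y0 y1] y2] /=; congr (_, _, _); ring. Qed.

Lemma LmulA x y z : Lmul x (Lmul y z) = Lmul (Lmul x y) z.
Proof.
case: x y z => [[x0 x1] x2] [[y0 y1] y2] [[z0 z1] z2] /=.
by congr (_, _, _); ring: mul_de.
Qed.

Lemma Lmul1 x : Lmul Lone x = x.
Proof. by case: x => [[x0 x1] x2] /=; congr (_, _, _); ring. Qed.

Lemma LmulZ a x y : Lmul (Lscale a x) y = Lscale a (Lmul x y).
Proof. by case: x y => [[x0 x1] x2] [[y0 y1] y2] /=; congr (_, _, _); ring. Qed.

Lemma LscaleA a b x : Lscale a (Lscale b x) = Lscale (a * b) x.
Proof. by case: x => [[x0 x1] x2] /=; rewrite !mulrA. Qed.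

Lemma Lscale1 x : Lscale 1 x = x.
Proof. by case: x => [[x0 x1] x2] /=; rewrite !mul1r. Qed.

Lemma LbarM x y : Lbar (Lmul x y) = Lmul (Lbar x) (Lbar y).
Proof.
case: x y => [[x0 x1] x2] [[y0 y1] y2] /=.
by rewrite !(rmorphD, rmorphM) /= bar_d bar_e.
Qed.

Lemma LbarZ a x : Lbar (Lscale a x) = Lscale (bar a) (Lbar x).
Proof. by case: x => [[x0 x1] x2] /=; rewrite !rmorphM. Qed.

Lemma LbarK x : Lbar (Lbar x) = x.
Proof. by case: x => [[x0 x1] x2] /=; rewrite !barK. Qed.

Lemma Lnorm_bar x : Lnorm (Lbar x) = bar (Lnorm x).
Proof.
case: x => [[x0 x1] x2] /=.
by rewrite !(rmorph_nat, rmorphD, rmorphM, rmorphN, rmorphXn) /= bar_d bar_e.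
Qed.

Lemma Lmul_adj x : Lmul x (Ladj x) = Lscale (Lnorm x) Lone.
Proof.
by case: x => [[x0 x1] x2] /=; congr (_, _, _); ring: mul_de.
Qed.

Lemma LnormM x y : Lnorm (Lmul x y) = Lnorm x * Lnorm y.
Proof. by case: x y => [[x0 x1] x2] [[y0 y1] y2] /=; ring: mul_de. Qed.

Lemma LnormZ a x : Lnorm (Lscale a x) = a ^+ 3 * Lnorm x.
Proof. by case: x => [[x0 x1] x2] /=; ring. Qed.

Lemma Lnorm1 : Lnorm Lone = 1.
Proof. by rewrite /=; ring. Qed.

(* With [t ^ 3 = d], multiplying by [d x1 - x2 t] eliminates the quadratic term; the
   binomial [x0 + x1 t] has norm [x0 ^ 3 + d x1 ^ 3], nonzero as [d] is not a cube. *)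
Lemma Lnorm_eq0 x : Lnorm x = 0 -> x = (0, 0, 0).
Proof.
have binomial (x0 x1 : F) : x0 ^+ 3 + d * x1 ^+ 3 = 0 -> x0 = 0 /\ x1 = 0.
  move=> N0; have [x10 | x1n0] := eqVneq x1 0.
    by move/eqP: N0; rewrite x10 expr0n mulr0 addr0 expf_eq0 => /andP[_ /eqP].
  case: (noncube_d (x := x0 / x1)).
  by rewrite expr_div_n (addr2_eq N0) mulfK // expf_neq0.
case: x => [[x0 x1] x2] N0; have [x20 | x2n0] := eqVneq x2 0.
  move: N0; rewrite x20 /= expr0n /= !mulr0 subr0 addr0.
  by case/binomial=> -> ->.
have [r1 r2] : d * (x0 * x1) - x2 ^+ 2 = 0 /\ d * x1 ^+ 2 - x0 * x2 = 0.
  apply: binomial; have := LnormM (x0, x1, x2) (d * x1, - x2, 0).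
  by rewrite N0 mul0r /= => <-; ring: mul_de.
case: (noncube_d (x := d * x1 / x2)).
rewrite expr_div_n; have -> : (d * x1) ^+ 3 = d * x2 ^+ 3; last first.
  by rewrite mulfK // expf_neq0.
have := subr0_eq r1; have := subr0_eq r2 => e2 e1.
rewrite [x2 ^+ 3]exprS -e1 exprMn [x1 ^+ 3]exprSr.
by transitivity (d ^+ 2 * x1 * (d * x1 ^+ 2)); [ring | rewrite e2; ring].
Qed.

(** * Transport of L to the Hermitian space F^3, and the two tori *)

Variable w : F.
Hypothesis tr_w : w + bar w = 1.
Implicit Types g : {'GL_3[F]}.

Definition Linv x := Lscale (Lnorm x)^-1 (Ladj x).

Lemma LmulV x : x <> (0, 0, 0) -> Lmul x (Linv x) = Lone.
Proof.
move=> x0; rewrite /Linv LmulC LmulZ LmulC Lmul_adj LscaleA mulVf ?Lscale1 //.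
by apply/eqP => /Lnorm_eq0.
Qed.

Lemma Lmx_mul x y : Lmx x *m Lmx y = Lmx (Lmul x y).
Proof.
case: x y => [[x0 x1] x2] [[y0 y1] y2] /=; rewrite mul_mx3.
by congr mx3; ring: mul_de.
Qed.

Lemma Lmx_cv x y : Lmx x *m Lcv y = Lcv (Lmul x y).
Proof.
case: x y => [[x0 x1] x2] [[y0 y1] y2] /=; rewrite mul_mx3_cv3.
by congr cv3; ring.
Qed.

Lemma Lmx1 : Lmx Lone = 1%:M.
Proof. by rewrite mx3_1 /= !mulr0. Qed.

Lemma det_Lmx x : \det (Lmx x) = Lnorm x.
Proof. by case: x => [[x0 x1] x2] /=; rewrite det_mx3; ring: mul_de. Qed.

Lemma Lmx_inj : injective Lmx.
Proof.
by move=> [[x0 x1] x2] [[y0 y1] y2] /mx3_inj[[-> _ _] [-> _ _] [-> _ _]].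
Qed.

Lemma LcvZ a x : Lcv (Lscale a x) = a *: Lcv x.
Proof. by case: x => [[x0 x1] x2] /=; rewrite scale_cv3. Qed.

(* The columns are the vectors identified with [1], [t], [t ^ 2 / d]; the last two span
   the chord. *)
Definition basis_mx := mx3 1 0 0 0 1 w 0 1 (bar w).
Definition basis_mxV := mx3 1 0 0 0 (bar w) w 0 1 1.
(** Gram matrix of the coefficient of 1 in a product of two elements of L. *)
Definition form_mx := mx3 1 0 0 0 0 1 0 1 0.

Lemma bar_w : bar w = 1 + w.
Proof. by rewrite -tr_w addrAC addrr2 add0r. Qed.

Lemma basis_mxK : basis_mx *m basis_mxV = 1%:M.
Proof. by rewrite mx3_1 mul_mx3 bar_w; congr mx3; ring_char2. Qed.

Lemma basis_mxVK : basis_mxV *m basis_mx = 1%:M.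
Proof. exact: mulmx1C basis_mxK. Qed.

Lemma det_basis_mx : \det basis_mx = 1.
Proof. by rewrite det_mx3 bar_w; ring_char2. Qed.

(** Thus [basis_mx] is an isometry from L, with the coefficient of 1 in bar(x) y as its form, onto
    the standard Hermitian space. *)
Lemma ctr_basis_mx : ctr basis_mx *m basis_mx = form_mx.
Proof.
rewrite ctr_mx3 mul_mx3 barK !(rmorph1, rmorph0) bar_w.
by congr mx3; ring_char2.
Qed.

Lemma form_mxK : form_mx *m form_mx = 1%:M.
Proof. by rewrite mul_mx3 mx3_1; congr mx3; ring. Qed.

(* Multiplications are self-adjoint for the trace form [x0 y0 + x1 y2 + x2 y1]. *)
Lemma Lmx_form x y : ctr (Lmx x) *m form_mx *m Lmx y = form_mx *m Lmx (Lmul (Lbar x) y).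
Proof.
rewrite -Lmx_mul mulmxA; congr (_ *m _).
case: x => [[x0 x1] x2] /=; rewrite ctr_mx3 !mul_mx3 !rmorphM /= bar_d bar_e.
by congr mx3; ring.
Qed.

Lemma torus_lift x : Lmul (Lbar x) x = Lone -> Lnorm x = 1 ->
  exists2 g, g \in SU3 F & GLval g *m basis_mx = basis_mx *m Lmx x.
Proof.
move=> x1 nx.
have [|| g Gg gE] := SU3_lift (A := basis_mx *m Lmx x *m basis_mxV).
- rewrite !ctrM !mulmxA -(mulmxA _ (ctr basis_mx)) ctr_basis_mx.
  rewrite -(mulmxA _ (ctr (Lmx x))) -(mulmxA _ (ctr (Lmx x) *m _)) Lmx_form x1.
  rewrite Lmx1 mulmx1 -ctr_basis_mx mulmxA -ctrM basis_mxK.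
  by rewrite /ctr map_mx1 trmx1 mul1mx basis_mxK.
- rewrite !det_mulmx det_Lmx nx det_basis_mx !mul1r.
  by have := det_basis_mx; rewrite -[RHS](det1 F 3) -basis_mxK det_mulmx det_basis_mx mul1r.
by exists g; rewrite // gE -!mulmxA basis_mxVK mulmx1.
Qed.

Definition cubic_torus :=
  [set g in SU3 F | [exists x : F * F * F, GLval g *m basis_mx == basis_mx *m Lmx x]].

Lemma cubic_torusP g :
  reflect (g \in SU3 F /\ exists x, GLval g *m basis_mx = basis_mx *m Lmx x)
          (g \in cubic_torus).
Proof.
rewrite [X in reflect _ X]inE.
apply: (iffP andP) => [[Gg /existsP[x /eqP gx]] | [Gg [x gx]]].
  by split=> //; exists x.
by split=> //; apply/existsP; exists x; apply/eqP.
Qed.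

(** Converse of [torus_lift]: as [g] preserves the Hermitian form, multiplication by bar(x) x must
    be the identity, because [form_mx] is invertible. *)
Lemma cubic_torus_unit g x : g \in SU3 F -> GLval g *m basis_mx = basis_mx *m Lmx x ->
  Lmul (Lbar x) x = Lone /\ Lnorm x = 1.
Proof.
case/SU3P=> _ gg dg gx; split; last first.
  rewrite -det_Lmx; move/(congr1 determinant): gx.
  by rewrite !det_mulmx dg det_basis_mx !mul1r.
have eq_form : ctr (Lmx x) *m form_mx *m Lmx x = form_mx.
  transitivity (ctr (basis_mx *m Lmx x) *m (basis_mx *m Lmx x)).
    by rewrite ctrM -ctr_basis_mx !mulmxA.
  by rewrite -gx ctrM -mulmxA (mulmxA (ctr (GLval g))) gg mul1mx ctr_basis_mx.
rewrite Lmx_form in eq_form; apply: Lmx_inj.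
by rewrite Lmx1 -[LHS]mul1mx -form_mxK -mulmxA eq_form.
Qed.

Lemma cubic_torus_group_set : group_set cubic_torus.
Proof.
apply/group_setP; split=> [|g h /cubic_torusP[Gg [x gx]] /cubic_torusP[Gh [y hy]]].
  by apply/cubic_torusP; rewrite group1; split=> //; exists Lone; rewrite GL_1E mul1mx Lmx1 mulmx1.
apply/cubic_torusP; rewrite groupM //; split=> //; exists (Lmul x y).
by rewrite GL_MxE -mulmxA hy mulmxA gx -mulmxA Lmx_mul.
Qed.
Canonical cubic_torus_group := Group cubic_torus_group_set.

Lemma basis_mx_inj (A B : 'M[F]_3) : A *m basis_mx = B *m basis_mx -> A = B.
Proof.
by move/(congr1 (mulmx^~ basis_mxV)); rewrite /= -!mulmxA basis_mxK !mulmx1.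
Qed.

Lemma cubic_torus_abelian : abelian cubic_torus.
Proof.
apply/centsP=> g /cubic_torusP[_ [x gx]] h /cubic_torusP[_ [y hy]].
apply: GL_inj; rewrite !GL_MxE; apply: basis_mx_inj.
by rewrite -!mulmxA hy gx !mulmxA hy gx -!mulmxA !Lmx_mul LmulC.
Qed.

(** Membership in [SU3 F] forces [y] to have norm 1. The isotropic points of the chord are the (0 :
    z : 1) with z of norm 1; the torus multiplies z by [y ^+ 2], and squaring is bijective on
    elements of norm 1, so the action is regular. *)
Definition chord_torus :=
  [set g in SU3 F | [exists y, GLval g == mx3 1 0 0 0 y 0 0 0 y^-1]].

Lemma chord_torusP g :
  reflect (g \in SU3 F /\ exists2 y, y * bar y = 1 & GLval g = mx3 1 0 0 0 y 0 0 0 y^-1)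
          (g \in chord_torus).
Proof.
rewrite [X in reflect _ X]inE.
apply: (iffP andP) => [[Gg /existsP[y /eqP gy]] | [Gg [y y1 gy]]].
  split=> //; exists y => //; have [gg _ _] := SU3P _ Gg.
  move: gg; rewrite gy ctr_mx3 mul_mx3 mx3_1 => /mx3_inj[_ [_ + _] _].
  by rewrite !(mulr0, mul0r, add0r, addr0, rmorph0).
by split=> //; apply/existsP; exists y; apply/eqP.
Qed.

Lemma chord_torus_group_set : group_set chord_torus.
Proof.
apply/group_setP; split=> [|g h /chord_torusP[Gg [x x1 gx]] /chord_torusP[Gh [y y1 hy]]].
  apply/chord_torusP; rewrite group1; split=> //; exists 1; rewrite ?rmorph1 ?mulr1 //.
  by rewrite GL_1E invr1 -mx3_1.
apply/chord_torusP; rewrite groupM //; split=> //; exists (x * y).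
  by rewrite rmorphM mulrACA x1 y1 mulr1.
by rewrite GL_MxE gx hy mul_mx3 invfM; congr mx3; ring.
Qed.
Canonical chord_torus_group := Group chord_torus_group_set.

Lemma chord_torus_abelian : abelian chord_torus.
Proof.
apply/centsP=> g /chord_torusP[_ [x _ gx]] h /chord_torusP[_ [y _ hy]].
apply: GL_inj; rewrite !GL_MxE gx hy !mul_mx3; congr mx3; ring.
Qed.

Lemma chord_lift y : y * bar y = 1 ->
  exists2 g, g \in chord_torus & GLval g = mx3 1 0 0 0 y 0 0 0 y^-1.
Proof.
move=> y1; have y0 : y != 0 by apply: contra_eq_neq y1 => ->; rewrite mul0r eq_sym oner_eq0.
have yV : y^-1 = bar y by apply: (mulfI y0); rewrite mulfV.
have [|| g Gg gE] := SU3_lift (A := mx3 1 0 0 0 y 0 0 0 y^-1).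
- rewrite ctr_mx3 mul_mx3 mx3_1 yV barK !(rmorph0, rmorph1).
  by congr mx3; rewrite ?(mulr0, mul0r, add0r, addr0, mulr1) // mulrC.
- by rewrite det_mx3 divff // !(mulr0, mul0r, subr0, addr0, mulr1).
by exists g => //; apply/chord_torusP; split=> //; exists y.
Qed.

(** * Regularity of the product of the two tori on isotropic points *)

Lemma SU3_isotropic g y0 y1 y2 : g \in SU3 F -> GLval g *m isoP = cv3 y0 y1 y2 ->
  bar y0 * y0 + bar y1 * y1 + bar y2 * y2 = 0.
Proof.
case/SU3P=> _ gg _ gP.
have: (map_mx bar (GLval g *m isoP))^T *m (GLval g *m isoP) = (map_mx bar isoP)^T *m isoP.
  by rewrite map_mxM trmx_mul -mulmxA (mulmxA _ (GLval g)) -/(ctr _) gg mul1mx.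
rewrite gP => /matrixP/(_ 0 0).
rewrite !mxE !big_ord_recl !big_ord0 !mxE /= !(rmorph0, rmorph1) !mulr1 mulr0 addr0.
by rewrite add0r addrA addr0 two0.
Qed.

Lemma basis_mx_coord (v : 'cV[F]_3) : exists x, v = basis_mx *m Lcv x.
Proof.
have [x0 [x1 [x2 xE]]] := cv3P (basis_mxV *m v).
by exists (x0, x1, x2); rewrite /= -xE mulmxA basis_mxK mul1mx.
Qed.

Lemma Lcv_inj : injective Lcv.
Proof. by move=> [[x0 x1] x2] [[y0 y1] y2] /cv3_inj[-> -> ->]. Qed.

Lemma basis_mx_cv_inj x y : basis_mx *m Lcv x = basis_mx *m Lcv y -> x = y.
Proof.
by move/(congr1 (mulmx basis_mxV)); rewrite !mulmxA basis_mxVK !mul1mx => /Lcv_inj.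
Qed.

Lemma SU3_isotropic_coord g x : g \in SU3 F -> GLval g *m isoP = basis_mx *m Lcv x ->
  (Lmul (Lbar x) x).1.1 = 0.
Proof.
case: x => [[x0 x1] x2] Gg; rewrite mul_mx3_cv3 => /(SU3_isotropic Gg) iso /=.
rewrite -[RHS]iso !(rmorphD, rmorphM) /= barK !(rmorph1, rmorph0) bar_w.
by ring_char2.
Qed.

Lemma Lmul_bar_real x : Lbar (Lmul (Lbar x) x) = Lmul (Lbar x) x.
Proof. by rewrite LbarM LbarK LmulC. Qed.

(* In characteristic 2, [(0, n1, n2) ^ 2 = (0, e n2 ^ 2, d n1 ^ 2)]. *)
Lemma Lsqrt_real x : Lbar x = x -> x.1.1 = 0 ->
  exists n1 n2, [/\ bar n1 = n1, bar n2 = n2 & Lmul (0, n1, n2) (0, n1, n2) = x].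
Proof.
case: x => [[x0 x1] x2] /= [_ r1 r2] ->.
have [n1 n1E] := sqrt_ex (e * x2); have [n2 n2E] := sqrt_ex (d * x1).
exists n1, n2; split.
- by apply: sqr_inj; rewrite -rmorphXn n1E rmorphM /= bar_e r2.
- by apply: sqr_inj; rewrite -rmorphXn n2E rmorphM /= bar_d r1.
rewrite -!expr2 n1E n2E; congr (_, _, _); last by ring: mul_de.
  by ring_char2.
by ring: mul_de.
Qed.

Lemma Lmul0 x : Lmul (0, 0, 0) x = (0, 0, 0).
Proof. by case: x => [[x0 x1] x2] /=; congr (_, _, _); ring. Qed.

Lemma Lmul_eq0 x y : Lmul x y = (0, 0, 0) -> x <> (0, 0, 0) -> y = (0, 0, 0).
Proof.
move=> xy0 x0; rewrite -[y]Lmul1 -(LmulV x0) [Lmul x _]LmulC -LmulA xy0.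
by rewrite LmulC Lmul0.
Qed.

Lemma LmulIr x y z : z <> (0, 0, 0) -> Lmul x z = Lmul y z -> x = y.
Proof.
move=> z0 /(congr1 (Lmul^~ (Linv z))).
by rewrite /= -!LmulA LmulV // ![Lmul _ Lone]LmulC !Lmul1.
Qed.

Lemma LmulACA x y z t : Lmul (Lmul x y) (Lmul z t) = Lmul (Lmul x z) (Lmul y t).
Proof. by rewrite -!LmulA (LmulA y) [Lmul y z]LmulC -LmulA. Qed.

Lemma LmulZr a x y : Lmul x (Lscale a y) = Lscale a (Lmul x y).
Proof. by rewrite LmulC LmulZ LmulC. Qed.

Lemma Lbar0 : Lbar (0, 0, 0) = (0, 0, 0).
Proof. by rewrite /= rmorph0. Qed.

(** Write the image of [isoP] under [g] as an element x of L, and x = u m with m on the chord and u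
    unitary. A multiple of u lies in the cubic torus, and the chord torus carries the point of
    [isoP] to that of m. *)
Lemma torus_cover g : g \in SU3 F ->
  exists2 a, a \in cubic_torus &
  exists2 b, b \in chord_torus & (b^-1 * (a^-1 * g))%g \in line_stab.
Proof.
move=> Gg; have [x gx] := basis_mx_coord (GLval g *m isoP).
have iso := SU3_isotropic_coord Gg gx.
have x_neq0 : x <> (0, 0, 0).
  move=> x0; move: gx; rewrite x0 [Lcv _](_ : _ = 0) ?mulmx0; last first.
    by apply/matrixP => i j; rewrite ord1; elim/forall_ord3: i; rewrite !mxE.
  move/mulmx_GLV; rewrite mulmx0 => /matrixP/(_ 1 0)/eqP.
  by rewrite !mxE oner_eq0.
have [n1 [n2 [r1 r2 nn]]] := Lsqrt_real (Lmul_bar_real x) iso.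
set m := (0, n1, n2) in nn.
have bar_m : Lbar m = m by rewrite /= rmorph0 r1 r2.
have m_neq0 : m <> (0, 0, 0).
  move=> m0; move: nn; rewrite m0 Lmul0 => /esym/Lmul_eq0 x0.
  by apply: (x_neq0); apply: x0 => /(congr1 Lbar); rewrite LbarK Lbar0.
pose u := Lmul x (Linv m).
have um : Lmul u m = x by rewrite -LmulA [Lmul _ m]LmulC LmulV // LmulC Lmul1.
have uu : Lmul (Lbar u) u = Lone.
  apply: (LmulIr (z := Lmul m m)).
    by move=> /Lmul_eq0/(_ m_neq0).
  by rewrite LmulACA um -{1}bar_m -LbarM um Lmul1 nn.
(* The norm of [u] has norm 1 over the subfield but need not be 1. The scalar [f] corrects it,
   without changing the action on points. *)
have [|f f3 ff] := cube_norm1_ex (a := Lnorm u).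
  by rewrite -Lnorm_bar mulrC -LnormM uu Lnorm1.
have [|| a Ga aE] := torus_lift (x := Lscale f u).
- by rewrite LbarZ LmulZ LmulZr LscaleA mulrC ff uu Lscale1.
- by rewrite LnormZ.
have f0 : f != 0 by apply: contra_eq_neq ff => ->; rewrite mul0r eq_sym oner_eq0.
pose y := n1 + w * n2.
have mE : basis_mx *m Lcv m = cv3 0 y (bar y).
  rewrite /y rmorphD rmorphM /= r1 r2 mul_mx3_cv3.
  by congr cv3; rewrite ?mul1r ?(mul0r, mulr0, addr0, add0r).
have y0 : y != 0.
  apply/eqP => y0; apply: m_neq0; apply: basis_mx_cv_inj; rewrite mE y0 rmorph0 /=.
  by rewrite mul_mx3_cv3 !mulr0 !addr0.
have yb0 : bar y != 0 by rewrite bar_eq0.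
(* Chosen so that (0, b, 1/b), the image of [isoP] under the chord torus, is proportional to (0, y,
   bar y). *)
have [b bE] := sqrt_ex (y / bar y).
have b1 : b * bar b = 1.
  apply: sqr_inj; rewrite expr1n exprMn -rmorphXn bE rmorphM fmorphV /= barK.
  by rewrite mulrA mulfVK // divff.
have b0 : b != 0 by apply: contra_eq_neq b1 => ->; rewrite mul0r eq_sym oner_eq0.
have [c Cc cE] := chord_lift b1.
exists a; first by apply/cubic_torusP; split=> //; exists (Lscale f u).
exists c => //; have [Gc _] := chord_torusP _ Cc.
apply/line_stabP; rewrite !(groupM, groupV) //; split=> //.
exists (f^-1 * (y / b)).
rewrite GL_MxE -mulmxA; apply/esym/mulmx_GLV; rewrite GL_MxE -mulmxA.
apply: mulmx_GLV; rewrite gx -!scalemxAr cE {1}/isoP mul_mx3_cv3.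
rewrite !(mulr0, mul0r, mulr1, addr0, add0r).
have -> : cv3 0 b b^-1 = (b / y) *: (basis_mx *m Lcv m).
  rewrite mE scale_cv3 mulr0 mulfVK //; congr cv3; apply: (mulfI b0).
  by rewrite mulfV // !mulrA -expr2 bE; field; rewrite y0 yb0.
rewrite -scalemxAr mulmxA aE -mulmxA Lmx_cv LmulZ um LcvZ -!scalemxAr !scalerA.
have -> : f^-1 * (y / b) * (b / y) * f = 1 by field; rewrite f0 y0 b0.
by rewrite scale1r.
Qed.

(** On the chord, squaring in L only squares and swaps the coordinates up to the factors [d] and
    [e], so it can be undone by uniqueness of square roots in F. *)
Lemma Lsqr_scale r p1 p2 m1 m2 :
  Lmul (0, p1, p2) (0, p1, p2) = Lscale (r ^+ 2) (Lmul (0, m1, m2) (0, m1, m2)) ->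
  (0, p1, p2) = Lscale r (0, m1, m2).
Proof.
have e_neq0 : e != 0 by apply: contra_eq_neq mul_de => ->; rewrite mulr0 eq_sym oner_eq0.
case; rewrite !(mul0r, mulr0, add0r) => _ eq2 eq1.
rewrite /= mulr0; congr (_, _, _); apply: sqr_inj.
  by apply: (mulfI d_neq0); rewrite expr2 eq1; ring.
by apply: (mulfI e_neq0); rewrite expr2 eq2; ring.
Qed.

(** Multiplying the relation a c P = k b P in L by its conjugate eliminates the unitary [s] and
    compares two squares on the chord. The two chord points then agree, which leaves [a] scalar, of
    norm 1 and determinant 1. *)
Lemma torus_inj a b c : a \in cubic_torus -> b \in chord_torus -> c \in chord_torus ->
  (b^-1 * (a * c))%g \in line_stab -> a = 1%g /\ b = c.
Proof.
move=> Ta Cb Cc; have [Ga [s aE]] := cubic_torusP _ Ta.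
have [Gb [y y1 bE]] := chord_torusP _ Cb.
have [Gc [z z1 cE]] := chord_torusP _ Cc.
have [ss Ns] := cubic_torus_unit Ga aE.
case/line_stabP=> _ [k]; rewrite GL_MxE -mulmxA => /mulmx_GLV; rewrite invgK GL_MxE -scalemxAr => acP.
(* These are the coordinates in L of (0, y, bar y), obtained by applying [basis_mxV]; they are
   traces, hence real. *)
pose coord (y : F) := (0, bar w * y + w * bar y, y + bar y) : F * F * F.
have coordE g x : x * bar x = 1 -> GLval g = mx3 1 0 0 0 x 0 0 0 x^-1 ->
    GLval g *m isoP = basis_mx *m Lcv (coord x).
  move=> x1 ->; have x0 : x != 0.
    by apply: contra_eq_neq x1 => ->; rewrite mul0r eq_sym oner_eq0.
  have -> : x^-1 = bar x by apply: (mulfI x0); rewrite mulfV.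
  by rewrite /isoP !mul_mx3_cv3 bar_w; congr cv3; ring_char2.
have bar_coord x : Lbar (coord x) = coord x.
  by rewrite /= !(rmorphD, rmorphM, rmorph0) /= !barK; congr (_, _, _); exact: addrC.
have sz : Lmul s (coord z) = Lscale k (coord y).
  apply: basis_mx_cv_inj; rewrite LcvZ -scalemxAr -(coordE b) // -acP.
  by rewrite -mulmxA (coordE c z) // mulmxA aE -mulmxA Lmx_cv.
have zz : Lmul (coord z) (coord z) = Lscale (k * bar k) (Lmul (coord y) (coord y)).
  rewrite -[LHS]Lmul1 -ss LmulACA sz -{1}(bar_coord z) -LbarM sz.
  by rewrite LbarZ bar_coord LmulZ LmulZr LscaleA mulrC.
have [r rE] := sqrt_ex (k * bar k).
have bar_r : bar r = r.
  by apply: sqr_inj; rewrite -rmorphXn rE rmorphM /= barK mulrC.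
have zry : coord z = Lscale r (coord y) by apply: Lsqr_scale; rewrite rE -zz.
(* Here z = r y, where y and z have norm 1 and r is real, so [r ^+ 2 = 1]. *)
have r1 : r = 1.
  have: GLval c *m isoP = r *: (GLval b *m isoP).
    by rewrite (coordE c z) // (coordE b y) // zry LcvZ -scalemxAr.
  rewrite cE bE /isoP !mul_mx3_cv3 scale_cv3 !(mul0r, mulr0, mulr1, addr0, add0r).
  case/cv3_inj=> _ zy _; apply: sqr_inj; rewrite expr1n -z1 zy rmorphM /= bar_r.
  by rewrite mulrACA y1 mulr1.
have coord_yz : coord z = coord y by rewrite zry r1 Lscale1.
have eq_yz : y = z.
  have: GLval b *m isoP = GLval c *m isoP.
    by rewrite (coordE c z) // (coordE b y) // coord_yz.
  rewrite cE bE /isoP !mul_mx3_cv3 !(mul0r, mulr0, mulr1, addr0, add0r).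
  by case/cv3_inj.
have y0 : coord y <> (0, 0, 0).
  move=> y0; have := coordE b y y1 bE; rewrite y0 bE /= /isoP !mul_mx3_cv3.
  rewrite !(mul0r, mulr0, mulr1, addr0, add0r) => /cv3_inj[_ y_eq0 _].
  by move/eqP: y1; rewrite y_eq0 mul0r eq_sym oner_eq0.
have sE : s = Lscale k Lone.
  by apply: (LmulIr y0); rewrite LmulZ Lmul1 -sz coord_yz.
(* The norm from L of the scalar [k] is its cube, and [k * bar k] is [r ^+ 2 = 1]. *)
have k1 : k = 1.
  apply: cube_norm1_inj; first by rewrite -Ns sE LnormZ Lnorm1 mulr1.
  by rewrite -rE r1 expr1n.
split; last by apply: GL_inj; rewrite bE cE eq_yz.
apply: GL_inj; apply: basis_mx_inj.
by rewrite aE sE k1 Lscale1 Lmx1 GL_1E mul1mx mulmx1.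
Qed.

End CubicAlgebra.

(** * The factorization of SU_3(q) and its passage to PSU_3(q) *)

Lemma has_MLS_PSU3 : has_MLS (PSU3 F).
Proof.
have [d [bar_d d0 noncube_d]] := noncube_ex; have [w tr_w] := trace1_ex.
have de : d * d^-1 = 1 by rewrite mulfV.
apply: (has_MLS_quotient_mul (A := cubic_torus_group de w) (B := chord_torus_group)
  (H := line_stab_group)).
- exact: center_normal.
- exact: center_sub_line_stab.
- by apply/subsetP=> g /line_stabP[].
- by apply/subsetP=> g /cubic_torusP[].
- by apply/subsetP=> g /chord_torusP[].
- by apply: abelian_sol; apply: cubic_torus_abelian.
- by apply: abelian_sol; apply: chord_torus_abelian.
- exact: line_stab_solvable.
- exact: torus_cover.
- exact: torus_inj.
Qed.
End QuadraticField.

(* F is (any model of) GF(q^2) with q = 2^n; PSU3 F is PSU_3(q). *)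
Theorem theorem4p2 (n : nat) (F : finFieldType) :
  (1 < n)%N -> #|F| = ((2 ^ n) ^ 2)%N ->
  (prime (2 ^ n + 1) \/ prime ((2 ^ n) ^ 2 - 2 ^ n + 1)) ->
  has_MLS (PSU3 F).
Proof.
move=> n_gt1 cardF /(prime_criterion_even n_gt1) even_n.
apply: (has_MLS_PSU3 (ltnW n_gt1) cardF).
(* For even n, q is a power of 4, hence 1 modulo 3. *)
have -> : n = n./2.*2 by rewrite -{1}(odd_double_half n) (negPf even_n).
by rewrite -mul2n expnM -modnXm exp1n.
Qed.
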